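(* Let $T_h$ be the complete binary tree of height $h$. Then for all sufficiently large $h$ we have $$P(T_h)\geq |V(T_h)|-172,$$ where $P(T_h)$ denotes the pegging number of $T_h$.
   Context: A distribution $D$ of pegs on a graph $G$ is a subset of $V(G)$ (the vertices holding one peg each). A pegging move from $D$ to $D'$: there are distinct vertices $u,v\in D$ and $w\notin D$ with both $u$ and $w$ adjacent to $v$, and $D'=(D\setminus\{u,v\})\cup\{w\}$. A vertex $x$ is reachable from $D$ if some finite (possibly empty) sequence of pegging moves starting at $D$ yields a distribution containing $x$. The reach $R(D)$ is the set of vertices reachable from $D$; $G$ can be pegged by $D$ if $R(D)=V(G)$. The pegging number $P(G)$ is the smallest natural number such that $G$ can be pegged by every distribution of size $P(G)$. The complete binary tree $T_h$ of height $h$ is the rooted tree in which every vertex at distance less than $h$ from the root has exactly two children and the leaves are exactly the vertices at distance $h$ from the root. *)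

(* Defs.v *)
From mathcomp Require Import all_boot.

Set Implicit Arguments.
Unset Strict Implicit.
Unset Printing Implicit Defensive.

Record sgraph := SGraph {
  svertex :> finType;
  sedge : rel svertex;
  sedge_sym : symmetric sedge;
  sedge_irrefl : irreflexive sedge }.

Definition pegging_move (G : sgraph) (D D' : {set G}) : bool :=
  [exists u : G, exists v : G, exists w : G,
    [&& u \in D, v \in D, u != v, w \notin D, sedge u v, sedge w v
      & D' == w |: (D :\: [set u; v])]].

(* [connect] is the reflexive-transitive closure, so the empty sequence of
   moves is allowed. *)
Definition reach (G : sgraph) (D : {set G}) : {set G} :=
  [set x | [exists D' : {set G}, connect (@pegging_move G) D D' && (x \in D')]].

Definition pegged_by (G : sgraph) (D : {set G}) : bool := reach D == [set: G].

Definition pegged_by_all_of_size (G : sgraph) (n : nat) : bool :=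
  [forall D : {set G}, (#|D| == n) ==> pegged_by D].

Lemma pegging_number_exists (G : sgraph) : exists n, pegged_by_all_of_size G n.
Proof.
exists #|G|; apply/forallP=> D; apply/implyP=> /eqP cardD.
have -> : D = [set: G].
  by apply/eqP; rewrite eqEcard subsetT cardsT cardD /=.
apply/eqP/setP=> x; rewrite !inE; apply/existsP; exists [set: G].
by rewrite connect0 inE.
Qed.

Definition pegging_number (G : sgraph) : nat := ex_minn (pegging_number_exists G).

(* The vertices of the complete binary tree of height [h] are the words of
   length at most [h] over [bool]: the root is the empty word and the children
   of a word [s] of length less than [h] are [true :: s] and [false :: s], so
   that the distance from the root is the length. *)
Definition cbt_child (h : nat) (s t : h.-bseq bool) : bool :=
  [exists b : bool, (t : seq bool) == b :: s].

Definition cbt_edge (h : nat) : rel (h.-bseq bool) :=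
  fun s t => cbt_child s t || cbt_child t s.

Lemma cbt_edge_sym (h : nat) : symmetric (@cbt_edge h).
Proof. by move=> s t; rewrite /cbt_edge orbC. Qed.

Lemma cbt_edge_irrefl (h : nat) : irreflexive (@cbt_edge h).
Proof.
move=> s; rewrite /cbt_edge orbb; apply/existsP=> -[b /eqP/(congr1 size)] /=.
exact/n_Sn.
Qed.

Definition complete_binary_tree (h : nat) : sgraph :=
  SGraph (@cbt_edge_sym h) (@cbt_edge_irrefl h).

(* Main.v *)
Require Import Defs.
From mathcomp Require Import all_boot zify.

Set Implicit Arguments.
Unset Strict Implicit.
Unset Printing Implicit Defensive.

(** Pegs far from a leaf of a large binary tree are almost worthless for
    reaching it, so a bounded number of empty vertices around the leaf makes it
    unreachable, however large the tree is.

    The measure of worth is a pagoda function: a weight [f] on the vertices with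
    [f w <= f u + f v] along every path [u], [v], [w].  No move increases the
    total weight of the pegs, so a vertex [x] is out of reach as soon as the
    pegs weigh less than [f x] ([reach_weight]).  If the vertices outside a set
    [H] weigh together less than [f x], every distribution that avoids [H]
    fails, hence the pegging number exceeds [#|G| - #|H|]
    ([pagoda_pegging_number]).

    The basic pagoda function is [r ^ d], where [r] is the golden section
    ([r ^ 2 + r = 1]) and [d] is the distance to the target, here a leaf.  A
    vertex of the tree lies [j] levels below the vertex at height [k] of the ray
    from the target to the root; the distance is [k + j], and there are
    [2 ^ j.-1] such vertices for [1 <= j <= k].  The total weight stays bounded
    because [2 * r ^ 2 < 1], but much of it sits on the leaves, and too many
    vertices would have to be emptied.  A leaf peg can move only by a jump over
    the peg of its parent, and this permits a lighter function: leaves get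
    weight 0 and in return their parents get the weight of the grandparents,
    except for the target, its sibling and its parent ([weight]).

    With these weights, 161 holes suffice ([hole]): the target, its sibling, and
    every inner vertex of the subtree of height 8 around the target except the
    bottom two layers of inner vertices of its far half ([card_holes]).  With
    [P e] for [r ^ e], the rest of that subtree weighs [96 * P 14], and the
    vertices that branch off at a height [k >= 9] weigh [2 ^ (k - 2) *
    (P (2 * k - 4) + P (2 * k - 2)) - P (k - 1)] for each [k]
    ([row_sum_weight]).  These terms telescope, and the outside weighs at most
    [96 * P 14 + 128 * (P 11 + P 13) - P 6], about 0.95 ([sum_light],
    [sum_light_lt]).

    To stay within the natural numbers, [r ^ e] is scaled to the Fibonacci
    number of index [M - e], for [M] larger than all exponents in use.  The
    identities of the golden section that the proof uses all follow from
    [r ^ e = r ^ e.+1 + r ^ e.+2], which the Fibonacci numbers satisfy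
    exactly. *)

(** * Pagoda functions *)

Section Pagoda.

Variables (G : sgraph) (f : G -> nat).

Definition pagoda :=
  forall u v w : G, sedge u v -> sedge w v -> u != w -> f w <= f u + f v.

Hypothesis pagoda_f : pagoda.

Lemma pegging_move_weight (D D' : {set G}) :
  pegging_move D D' -> \sum_(v in D') f v <= \sum_(v in D) f v.
Proof.
case/existsP=> u /existsP[v] /existsP[w].
case/and5P=> uD vD uv wD /and3P[euv ewv /eqP->].
have uw : u != w by apply: contraNneq wD => <-.
rewrite big_setU1 /=; last by rewrite !inE (negPf wD) andbF.
rewrite [X in _ <= X](bigD1 u) //= [X in _ <= _ + X](bigD1 v) /=; last first.
  by rewrite vD eq_sym.
rewrite addnA leq_add //; first exact: pagoda_f.
rewrite (eq_bigl (fun i => (i \in D) && (i != u) && (i != v))) //.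
by move=> i; rewrite !inE negb_or andbC andbA.
Qed.

Lemma reach_weight (D : {set G}) x :
  x \in reach D -> f x <= \sum_(v in D) f v.
Proof.
rewrite inE => /existsP[D' /andP[/connectP[p pth ->] xD']].
have: f x <= \sum_(v in last D p) f v by rewrite (bigD1 x) //= leq_addr.
move/leq_trans; apply; elim: p D pth {xD'} => //= D1 p IHp D /andP[mv pth].
exact: leq_trans (IHp _ pth) (pegging_move_weight mv).
Qed.

Lemma pagoda_pegging_number (H : {set G}) x :
  \sum_(v in ~: H) f v < f x -> #|G| - #|H| < pegging_number G.
Proof.
move=> light; rewrite /pegging_number; case: ex_minnP => n /forallP pegs _.
rewrite ltnNge; apply/negP => le_n.
have {le_n} /set0Pn[D] : [set D : {set G} | D \subset ~: H & #|D| == n] != set0.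
  by rewrite -card_gt0 cards_draws bin_gt0 cardsCs setCK.
rewrite inE => /andP[sDH cardD].
have /eqP reachD := implyP (pegs D) cardD.
have /reach_weight : x \in reach D by rewrite reachD.
apply/negP; rewrite -ltnNge; apply: leq_ltn_trans light.
rewrite [X in _ <= X](big_setID D) /= (setIidPr sDH); exact: leq_addr.
Qed.

End Pagoda.

(** * Words and the position of a vertex relative to the ray *)

Fixpoint words (n : nat) : seq (seq bool) :=
  if n is m.+1 then
    [::] :: map (cons true) (words m) ++ map (cons false) (words m)
  else [:: [::]].

Lemma mem_words n s : (s \in words n) = (size s <= n).
Proof.
elim: n s => [|n IHn] [|b s] //=; rewrite inE mem_cat /=.
have inj c : injective (cons c : seq bool -> seq bool) by move=> ? ? [].
have nin c t : t != c -> (t :: s \in map (cons c) (words n)) = false.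
  by move=> tc; apply/mapP=> -[s' _ [/eqP]]; rewrite (negPf tc).
case: b; first by rewrite (nin false) // orbF (mem_map (inj _)) IHn.
by rewrite (nin true) // (mem_map (inj _)) IHn.
Qed.

Lemma words_uniq n : uniq (words n).
Proof.
elim: n => //= n IHn.
have inj c : injective (cons c : seq bool -> seq bool) by move=> ? ? [].
rewrite mem_cat cat_uniq !map_inj_uniq // IHn andbT /=; apply/andP; split.
  by rewrite negb_or; apply/andP; split; apply/mapP=> -[].
by apply/hasPn=> _ /mapP[s _ ->]; apply/mapP=> -[].
Qed.

(** Vertices are read from the root downwards, that is reversed, so that the
    recursion on [words] splits the tree at its root. *)
Lemma big_bseq_words n (g : seq bool -> nat) :
  \sum_(v : n.-bseq bool) g (rev v) = \sum_(s <- words n) g s.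
Proof.
rewrite -(big_map (fun v : n.-bseq bool => rev v) xpredT g).
apply: perm_big; apply: uniq_perm; last 1 first.
- move=> s; rewrite mem_words; apply/mapP/idP => [[v _ ->]|sz].
    by rewrite size_rev size_bseq.
  have sz' : size (rev s) <= n by rewrite size_rev.
  by exists (Bseq sz'); rewrite ?mem_index_enum //= revK.
- rewrite map_inj_uniq ?index_enum_uniq // => u v /(can_inj revK).
  exact: val_inj.
- exact: words_uniq.
Qed.

Lemma sum_words_size n (g : nat -> nat) :
  \sum_(s <- words n) g (size s) = \sum_(j < n.+1) 2 ^ j * g j.
Proof.
elim: n g => [|n IHn] g; first by rewrite big_seq1 big_ord1 mul1n.
rewrite big_cons big_cat !big_map /= (IHn (fun j => g j.+1)) addnn.
rewrite [RHS]big_ord_recl mul1n; congr (_ + _); rewrite -mul2n big_distrr /=.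
by apply: eq_bigr => j _; rewrite mulnA -expnS.
Qed.

(** The pair [(k, j)] of the vertex that [s], read from the root, denotes in the
    tree of height [h]: the ray goes from the root to the leaf [true ... true],
    [k] is the height at which [s] leaves it, and [j] counts the steps after. *)
Fixpoint position (h : nat) (s : seq bool) : nat * nat :=
  if s is b :: s' then if b then position h.-1 s' else (h, size s) else (h, 0).

(** The total of [g] over the part of the tree that hangs on the vertex of
    height [k] of the ray; [2 ^ j] vertices lie [j.+1] levels below it off the
    ray. *)
Definition row_sum (g : nat -> nat -> nat) (k : nat) : nat :=
  g k 0 + \sum_(j < k) 2 ^ j * g k j.+1.

Lemma sum_words_position n (g : nat -> nat -> nat) :
  \sum_(s <- words n) g (position n s).1 (position n s).2 =
  \sum_(k < n.+1) row_sum g k.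
Proof.
elim: n => [|n IHn]; first by rewrite big_seq1 big_ord1 /row_sum big_ord0 addn0.
rewrite big_cons big_cat !big_map big_ord_recr /= IHn.
by rewrite (sum_words_size n (fun j => g n.+1 j.+1)) addnCA addnA.
Qed.

(** * The weight function *)

Fixpoint fib (n : nat) : nat :=
  if n is (m.+1 as p).+1 then fib p + fib m else n.

Lemma fib_gt0 n : 0 < n -> 0 < fib n.
Proof. by elim: n => // -[|n] //= IHn _; rewrite addn_gt0 IHn. Qed.

Lemma fib_leS n : fib n <= fib n.+1.
Proof. by case: n => //= n; rewrite leq_addr. Qed.

Section Weight.

Variable M : nat.

(** A scaled power [r ^ e] of the golden section [r]. *)
Definition golden (e : nat) : nat := fib (M - e).

Lemma golden_rec e : e.+2 <= M -> golden e = golden e.+1 + golden e.+2.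
Proof.
move=> le_e; rewrite /golden; have -> : M - e = (M - e.+2).+2 by lia.
by have -> : M - e.+1 = (M - e.+2).+1 by lia.
Qed.

Lemma golden_le e : golden e.+1 <= golden e.
Proof. by rewrite /golden subnS; case: (M - e) => //= n; apply: fib_leS. Qed.

(** The target, its parent and its sibling ([k <= 1]) keep their golden weight:
    the sibling must weigh at least [r ^ 2] because of the jump from it over the
    parent to the target.  Further away a leaf ([j = k]) weighs nothing, and its
    parent ([j = k - 1]) as much as its grandparent ([r ^ (2 * k - 2)]), so that
    the parent alone pays for the jump of a leaf peg over it. *)
Definition weight (k j : nat) : nat :=
  if k <= 1 then golden (k + j)
  else if j == k then 0
  else if j.+1 == k then golden (k + j).-1
  else golden (k + j).

Lemma weight_ray k : weight k 0 = golden k.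
Proof. by case: k => [|[|k]]; rewrite /weight //= ?addn0. Qed.

Lemma weight_first k : 0 < k -> golden k.+1 <= weight k 1.
Proof.
case: k => [|[|[|k]]] // _; rewrite /weight //= ?addn1 //.
exact: golden_le.
Qed.

Lemma weight_antitone k j :
  j < k -> weight k j.+1 <= weight k j.
Proof.
move=> lt_jk; rewrite /weight addnS.
case: (leqP k 1) => [le_k1|lt_1k].
  exact: golden_le.
case: eqVneq => // ne1; rewrite (ltn_eqF lt_jk) /=.
case: eqVneq => // ne2.
exact: golden_le.
Qed.

Lemma weight_down k j :
  j.+2 <= k -> 2 * k <= M -> weight k j <= weight k j.+1 + weight k j.+2.
Proof.
move=> lt_jk le_k; rewrite /weight.
have -> : (k <= 1) = false by lia.
have -> : (j == k) = false by lia.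
have -> : (j.+1 == k) = false by lia.
rewrite !addnS /=.
case: eqVneq => [_|ne]; first by rewrite addn0.
case: eqVneq => [_|_]; rewrite golden_rec ?leq_add2l //; try lia.
exact: golden_le.
Qed.

Lemma weight_fork k :
  0 < k -> k < M -> weight k.-1 0 <= weight k 1 + weight k 0.
Proof.
case: k => // k _ le_k; rewrite !weight_ray golden_rec /=; last by lia.
by rewrite addnC leq_add2r weight_first.
Qed.

Definition wt (p : nat * nat) := weight p.1 p.2.

(** The next three lemmas are the pagoda inequalities for a path that ends in a
    grandchild, in a grandparent and in a sibling of its first vertex.  Off the
    ray the weight never grows away from the root, so only jumps towards the
    root need an argument there; on the ray it does grow, and the jumps that
    need the recurrence are those that land on a lower vertex of the ray. *)
Lemma wt_grandchild h s b c :
  (size s).+1 < h -> 2 * h + 2 <= M ->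
  wt (position h (rcons (rcons s b) c)) <=
    wt (position h s) + wt (position h (rcons s b)).
Proof.
elim: s h => [|a s IHs] [|h] //= lt_s le_h; last first.
  case: a; first by apply: IHs; lia.
  rewrite !size_rcons (leq_trans _ (leq_addl _ _)) //.
  by apply: weight_antitone => /=; lia.
case: b => /=; last first.
  rewrite (leq_trans _ (leq_addl _ _)) //.
  by apply: weight_antitone => /=; lia.
case: h lt_s le_h => // h lt_s le_h; rewrite /wt; case: c => /=.
  by rewrite !weight_ray [golden h]golden_rec 1?addnC //; lia.
rewrite (leq_trans _ (leq_addl _ _)) //.
by apply: weight_antitone => /=; lia.
Qed.

Lemma wt_grandparent h s b c :
  (size s).+1 < h -> 2 * h + 2 <= M ->
  wt (position h s) <=
    wt (position h (rcons (rcons s b) c)) + wt (position h (rcons s b)).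
Proof.
elim: s h => [|a s IHs] [|h] //= lt_s le_h; last first.
  case: a; first by apply: IHs; lia.
  by rewrite !size_rcons addnC; apply: weight_down => /=; lia.
case: b => /=; last by rewrite /wt addnC; apply: weight_down => /=; lia.
rewrite (leq_trans _ (leq_addl _ _)) // /wt !weight_ray; exact: golden_le.
Qed.

Lemma wt_fork h (s : seq bool) (b c : bool) :
  size s < h -> 2 * h + 2 <= M -> b != c ->
  wt (position h (rcons s b)) <=
    wt (position h (rcons s c)) + wt (position h s).
Proof.
move=> + + bc; elim: s h => [|a s IHs] [|h] //= lt_s le_h; last first.
  case: a; first by apply: IHs; lia.
  by rewrite !size_rcons leq_addr.
case: b c bc => [] [] //= _; rewrite /wt /=.
  by apply: (@weight_fork h.+1); lia.
by rewrite (leq_trans _ (leq_addl _ _)) //; apply: weight_antitone; lia.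
Qed.

(** A geometric sum of ratio [2 * r]; the term [golden k] comes from its lower
    end, since [2 * r - 1 = r ^ 3]. *)
Lemma sum_golden k n :
  k + n + 2 <= M ->
  \sum_(j < n) 2 ^ j * golden (k + j + 3) + golden k = 2 ^ n * golden (k + n).
Proof.
elim: n => [|n IHn] le_M; first by rewrite big_ord0 mul1n addn0.
rewrite big_ord_recr /= addnAC IHn; last by lia.
have := @golden_rec (k + n); have := @golden_rec (k + n).+1.
by rewrite expnS !addnS addn0; nia.
Qed.

(** At height [k.+2] the layers above the parents of the leaves form the
    geometric sum of [sum_golden], the parents add [2 ^ k] terms
    [golden (2 * k + 2)], and the vertex on the ray reduces the deficit
    [golden k] to [golden k.+1]. *)
Lemma row_sum_weight k :
  2 * k + 2 <= M ->
  row_sum weight k.+2 + golden k.+1 =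
  2 ^ k * (golden (2 * k) + golden (2 * k + 2)).
Proof.
move=> le_M; rewrite /row_sum weight_ray !big_ord_recr /=.
have -> : weight k.+2 k.+2 = 0 by rewrite /weight eqxx.
have -> : weight k.+2 k.+1 = golden (2 * k + 2).
  by rewrite /weight /= eqSS (ltn_eqF (ltnSn k)) eqxx; congr golden; lia.
rewrite (eq_bigr (fun j : 'I_k => 2 ^ j * golden (k + j + 3))); last first.
  move=> j _; have lt_jk := ltn_ord j; congr (_ * _); rewrite /weight /= !eqSS.
  rewrite (ltn_eqF lt_jk) (ltn_eqF (leqW lt_jk)).
  by congr golden; lia.
have := @sum_golden k k; rewrite addnn -mul2n => /(_ le_M) sum_k.
have golden_k : golden k = golden k.+1 + golden k.+2 by apply: golden_rec; lia.
rewrite muln0 mulnDr -sum_k golden_k; set X := \sum_(j < k) _; lia.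
Qed.

(** * The holes and the weight outside them *)

(** Emptying the vertices with [k <= 7] of positive weight leaves only a little
    more than the weight of the target; among those with [k = 8] the top layers
    are the heaviest, and the 32 vertices with [j <= 5] suffice. *)
Definition hole (k j : nat) : bool :=
  [&& k <= 8, (k <= 1) || (j < k) & (k <= 7) || (j <= 5)].

Definition light (k j : nat) : nat := ~~ hole k j * weight k j.

Lemma row_sum_light k : 8 < k -> row_sum light k = row_sum weight k.
Proof.
move=> lt_k; rewrite /row_sum /light /hole leqNgt lt_k /= mul1n.
by congr (_ + _); apply: eq_bigr => j _; rewrite mul1n.
Qed.

Lemma light_low k j :
  j <= k -> (k <= 7) || (k == 8) && (j <= 5) -> light k j = 0.
Proof.
rewrite /light /hole leq_eqVlt => /orP[/eqP-> | lt_jk] low.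
  rewrite /weight eqxx; case: (leqP k 1) => [le_k1|_] /=; last by rewrite muln0.
  by rewrite (leq_trans le_k1) // (leq_trans le_k1).
have -> : k <= 8 by lia.
by rewrite lt_jk orbT /=; have -> : (k <= 7) || (j <= 5) by lia.
Qed.

Lemma row_sum_light_8 : row_sum light 8 = 96 * golden 14.
Proof.
rewrite /row_sum !big_ord_recr big_ord0 /light /weight /=.
by rewrite -[8 + 6]/14 -[7 + 7]/14; lia.
Qed.

(** By [row_sum_weight], row [k >= 9] consists of a main term and a correction
    [- golden (k - 1)].  From row [m + 9] on, infinitely many main terms would
    add up to [2 ^ (m + 7) * (golden (2 * m + 11) + golden (2 * m + 13))] and
    the corrections to [golden (m + 6)]: this is why both telescope. *)
Lemma sum_light m :
  2 * m + 18 <= M ->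
  \sum_(k < (m + 8).+1) row_sum light k
    + golden 6 + 2 ^ (m + 7) * (golden (2 * m + 11) + golden (2 * m + 13))
  = 96 * golden 14 + 128 * (golden 11 + golden 13) + golden (m + 6).
Proof.
elim: m => [|m IHm] le_M.
  rewrite big_ord_recr big1 /= ?row_sum_light_8 => [|k _]; last first.
    have lt_k := ltn_ord k; rewrite /row_sum light_low //; last by lia.
    rewrite big1 // => j _; have lt_j := ltn_ord j.
    by rewrite light_low ?muln0 //; lia.
  rewrite -[2 * 0 + 11]/11 -[2 * 0 + 13]/13 -[0 + 6]/6 -[2 ^ (0 + 7)]/128; lia.
have -> : (m.+1 + 8) = (m + 7).+2 by lia.
have -> : 2 * m.+1 + 11 = 2 * m + 13 by lia.
have -> : 2 * m.+1 + 13 = 2 * m + 15 by lia.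
have -> : m.+1 + 7 = (m + 7).+1 by lia.
have -> : m.+1 + 6 = (m + 7) by lia.
rewrite big_ord_recr /= row_sum_light; last by lia.
have rec a i : a + i.+2 <= M ->
    golden (a + i) = golden (a + i.+1) + golden (a + i.+2).
  by move=> le_a; rewrite golden_rec ?addnS //; rewrite -?addnS.
have {}IHm := IHm (ltac:(lia)).
have := row_sum_weight (k := m + 7) (ltac:(lia)).
have -> : 2 * (m + 7) = 2 * m + 14 by lia.
have -> : 2 * m + 14 + 2 = 2 * m + 16 by lia.
move=> row; move: IHm.
have -> : golden (2 * m + 11) + golden (2 * m + 13) =
    golden (2 * m + 14) + golden (2 * m + 16) +
    2 * (golden (2 * m + 13) + golden (2 * m + 15)).
  have := rec (2 * m) 11; have := rec (2 * m) 12.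
  by have := rec (2 * m) 13; have := rec (2 * m) 14; lia.
have := rec m 6.
rewrite mulnDr -row mulnA -expnSr (_ : m + 8 = (m + 7).+1); last by lia.
by set S := \sum_(k < _) _; set T := _ * _; lia.
Qed.

Lemma golden_le_double e n : e + n < M -> golden e <= 2 ^ n * golden (e + n).
Proof.
elim: n => [|n IHn] le_M; first by rewrite mul1n addn0.
rewrite (leq_trans (IHn _)) ?expnSr -?mulnA ?leq_mul2l; try lia.
apply/orP; right; rewrite mul2n -addnn addnS golden_rec; last by lia.
by rewrite leq_add2l golden_le.
Qed.

(** In units of [golden 0] the bound that [sum_light] gives is about 0.95;
    expanding all terms by the recurrence down to [golden 19] and [golden 20]
    turns the claim into linear arithmetic. *)
Lemma sum_light_lt m :
  2 * m + 18 <= M -> 20 < M ->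
  \sum_(k < (m + 8).+1) row_sum light k < weight 0 0.
Proof.
move=> le_M le20; rewrite weight_ray.
(* The main terms beyond the last row outweigh the corrections beyond it:
   [r ^ (m + 6) <= 2 ^ (m + 5) * r ^ (2 * m + 11)], as [1 <= 2 * r]. *)
have le_pow :
  golden (m + 6) <= 2 ^ (m + 7) * (golden (2 * m + 11) + golden (2 * m + 13)).
  apply: leq_trans (golden_le_double (n := m + 5) _) _; first by lia.
  rewrite (_ : m + 6 + (m + 5) = 2 * m + 11); last by lia.
  by rewrite leq_mul ?leq_addr // leq_exp2l // leq_add2l.
have := sum_light le_M.
have pos : 0 < golden 20 by apply: fib_gt0; lia.
have rec e : e <= 18 -> golden e = golden e.+1 + golden e.+2.
  by move=> le_e; apply: golden_rec; lia.
have := rec 0 isT; have := rec 1 isT; have := rec 2 isT.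
have := rec 3 isT; have := rec 4 isT; have := rec 5 isT.
have := rec 6 isT; have := rec 7 isT; have := rec 8 isT.
have := rec 9 isT; have := rec 10 isT; have := rec 11 isT.
have := rec 12 isT; have := rec 13 isT; have := rec 14 isT.
have := rec 15 isT; have := rec 16 isT; have := rec 17 isT.
have := rec 18 isT.
set S := \sum_(k < _) _; move: le_pow.
set T := _ * (golden (2 * m + _) + _); lia.
Qed.

End Weight.

Lemma sum_hole h : 8 <= h -> \sum_(k < h.+1) row_sum hole k = 161.
Proof.
elim: h => // h IHh; rewrite leq_eqVlt => /orP[/eqP<-|lt_h].
  by rewrite /row_sum !(big_ord_recl, big_ord0).
rewrite big_ord_recr /= IHh // /row_sum /hole big1 => [|j _].
  by rewrite (_ : h.+1 <= 8 = false) //; lia.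
by rewrite (_ : h.+1 <= 8 = false) //; lia.
Qed.

(** * The complete binary tree *)

Section Tree.

Variable h : nat.
Local Notation T := (complete_binary_tree h).

Definition place (v : T) : nat * nat := position h (rev (v : h.-bseq bool)).

(** The largest exponent in use is [2 * h], and [golden 20] must be positive:
    the scale [2 * h + 21] leaves room for both. *)
Definition tree_weight (v : T) : nat := wt (2 * h + 21) (place v).

Lemma sum_place (g : nat -> nat -> nat) :
  \sum_(v : T) g (place v).1 (place v).2 = \sum_(k < h.+1) row_sum g k.
Proof. by rewrite -sum_words_position -big_bseq_words. Qed.

Lemma tree_edgeP (u v : h.-bseq bool) :
  cbt_edge u v ->
  exists b, rev v = rcons (rev u) b \/ rev u = rcons (rev v) b.
Proof.
by case/orP=> /existsP[b /eqP eq_uv]; exists b; [left|right];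
  rewrite eq_uv rev_cons.
Qed.

Lemma pagoda_tree_weight : pagoda tree_weight.
Proof.
move=> u v w /tree_edgeP[b uv] /tree_edgeP[c wv] ne_uw.
rewrite /tree_weight /place.
have size_le (t : h.-bseq bool) : size (rev t) <= h.
  by rewrite size_rev size_bseq.
have := size_le u; have := size_le v; have := size_le w.
case: uv wv => [uv|uv] [wv|wv].
- case/eqP: ne_uw; apply/val_inj/(can_inj revK).
  by move: wv; rewrite uv => /rcons_inj[].
- rewrite wv uv !size_rcons => *; apply: wt_grandchild; lia.
- rewrite uv wv !size_rcons => *; apply: wt_grandparent; lia.
rewrite uv wv !size_rcons => *; apply: wt_fork; try lia.
apply: contraNneq ne_uw => cb; apply/eqP/val_inj/(can_inj revK).
by rewrite uv wv cb.
Qed.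

Definition holes : {set T} := [set v | hole (place v).1 (place v).2].

Lemma card_holes : 8 <= h -> #|holes| = 161.
Proof.
move=> le_h; rewrite -(sum_hole le_h) -sum_place -sum1_card big_mkcond /=.
by apply: eq_bigr => v _; rewrite inE; case: hole.
Qed.

Definition target : T := @Bseq h bool (nseq h true) (eq_leq (size_nseq h true)).

Lemma place_target : place target = (0, 0).
Proof.
rewrite /place /= (_ : rev _ = nseq h true); last first.
  by apply: (@eq_from_nth _ true); rewrite size_rev ?size_nseq // => i lt_i;
     rewrite nth_rev ?size_nseq // !nth_nseq !if_same.
by elim: h => //= n ->.
Qed.

Lemma holes_light :
  8 <= h -> \sum_(v in ~: holes) tree_weight v < tree_weight target.
Proof.
move=> le_h; rewrite /tree_weight place_target.
have := @sum_light_lt (2 * h + 21) (h - 8); rewrite subnK //.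
rewrite -sum_place => light_lt.
apply: leq_ltn_trans (light_lt _ _); try lia.
rewrite big_mkcond; apply/eq_leq/eq_bigr => v _.
by rewrite !inE /light; case: hole; rewrite ?mul1n.
Qed.

End Tree.

Theorem theorem4p2 :
  exists h0 : nat, forall h : nat, h0 <= h ->
    pegging_number (complete_binary_tree h) >= #|complete_binary_tree h| - 172.
Proof.
exists 8 => h le_h.
have := pagoda_pegging_number (@pagoda_tree_weight h) (holes_light le_h).
rewrite card_holes // => /ltnW; apply: leq_trans.
exact: leq_sub2l.
Qed.
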